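(* Let $X,Y$ be real Banach spaces, let $C\subseteq X$ and $K\subseteq Y$ be nonempty closed convex sets, let $G:X\times X\to Y$ be Fréchet differentiable with respect to its second argument $y$, and let $\Phi(x)=\{y\in C:G(x,y)\in K\}$ for $x\in X$. Let $\bar{x}$ be a feasible point, i.e. $\bar{x}\in\Phi(\bar{x})$. Assume that $G$ is $K_\infty$-concave with respect to $y$, that $G$ and $D_yG$ satisfy the continuity property $$x^k\rightharpoonup x,\quad y^k\to y\quad\Longrightarrow\quad G(x^k,y^k)\to G(x,y),\quad D_yG(x^k,y^k)\to D_yG(x,y)$$ for all $x,y\in X$, and that the Robinson constraint qualification (RCQ) holds in $\bar{x}$. Then $\Phi$ is weakly Mosco-continuous in $\bar{x}$.
   Context: $D_yG(x,y)\in L(X,Y)$ is the Fréchet derivative of $G$ with respect to the second argument; convergence of $D_yG(x^k,y^k)$ is in the operator norm. Recession cone: $K_\infty:=\{y\in Y: y+K\subseteq K\}$. $G$ is $K_\infty$-concave with respect to $y$ if $G(x,(1-\alpha)y_1+\alpha y_2)-(1-\alpha)G(x,y_1)-\alpha G(x,y_2)\in K_\infty$ for all $x,y_1,y_2\in X$ and $\alpha\in[0,1]$. RCQ holds in $\bar{x}$ if $\bar{x}$ is feasible and $0\in\operatorname{int}[G(\bar{x},\bar{x})+D_yG(\bar{x},\bar{x})(C-\bar{x})-K]$ (interior in $Y$). Weak Mosco-continuity in $\bar{x}$: whenever $x^k\rightharpoonup\bar{x}$, the sets $S_k:=\Phi(x^k)$ Mosco converge to $S:=\Phi(\bar{x})$,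 meaning that (i) for every $y\in S$ there are points $y^k\in S_k$, defined for all sufficiently large $k$, with $y^k\to y$, and (ii) whenever $y^k\in S_k$ for all $k$ and $y$ is a weak limit point (weak limit of a subsequence) of $\{y^k\}$, then $y\in S$. *)

(* Defs.v *)
From HB Require Import structures.
From mathcomp Require Import all_boot all_order all_algebra.
From mathcomp Require Import all_classical all_reals all_analysis.

Set Implicit Arguments.
Unset Strict Implicit.
Unset Printing Implicit Defensive.

Import Order.TTheory GRing.Theory Num.Theory.
Import numFieldNormedType.Exports.

Local Open Scope classical_set_scope.
Local Open Scope ring_scope.

(* u k converges weakly to x: tested against the continuous dual of X. *)
Definition weak_cvg (R : realType) (X : normedModType R)
    (u : nat -> X) (x : X) : Prop :=
  forall f : {linear X -> R^o}, continuous f -> f (u k) @[k --> \oo] --> f x.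

(* Only meaningful for bounded linear T: sup is 0 on unbounded sets. *)
Definition operator_norm (R : realType) (X Y : normedModType R)
    (T : X -> Y) : R :=
  sup [set `|T h| | h in [set h : X | `|h| <= 1]].

Definition operator_cvg (R : realType) (X Y : normedModType R)
    (T_ : nat -> X -> Y) (T : X -> Y) : Prop :=
  operator_norm (fun h => T_ k h - T h) @[k --> \oo] --> (0 : R).

Definition recession_cone (R : realType) (Y : normedModType R)
    (K : set Y) : set Y :=
  [set y | [set y + z | z in K] `<=` K].

Definition concave_wrt_snd (R : realType) (X Y : normedModType R)
    (L : set Y) (G : X -> X -> Y) : Prop :=
  forall (x y1 y2 : X) (a : R), 0 <= a <= 1 ->
    L (G x ((1 - a) *: y1 + a *: y2) - (1 - a) *: G x y1 - a *: G x y2).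

Definition constraint_map (R : realType) (X Y : normedModType R)
    (C : set X) (K : set Y) (G : X -> X -> Y) (x : X) : set X :=
  [set y | C y /\ K (G x y)].

(* Robinson constraint qualification *)
Definition RCQ (R : realType) (X Y : normedModType R)
    (C : set X) (K : set Y) (G : X -> X -> Y) (xbar : X) : Prop :=
  constraint_map C K G xbar xbar /\
  interior [set G xbar xbar + 'd (G xbar) xbar (c - xbar) - z
           | c in C & z in K] 0.

(* In the first clause the values of y_ at the finitely many k with y_ k not
   in S_ k are irrelevant: they encode "defined for all large k". *)
Definition mosco_cvg (R : realType) (X : normedModType R)
    (S_ : nat -> set X) (S : set X) : Prop :=
  (forall y, S y -> exists y_ : nat -> X,
     (\forall k \near \oo, S_ k (y_ k)) /\ y_ @ \oo --> y) /\
  (forall (y_ : nat -> X) (y : X), (forall k, S_ k (y_ k)) ->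
     (exists phi : nat -> nat,
        {homo phi : m n / (m < n)%N} /\ weak_cvg (y_ \o phi) y) ->
     S y).

Definition weakly_mosco_continuous (R : realType) (X : normedModType R)
    (Phi : X -> set X) (xbar : X) : Prop :=
  forall x_ : nat -> X, weak_cvg x_ xbar ->
    mosco_cvg (fun k => Phi (x_ k)) (Phi xbar).

(* Main.v *)
Require Import Defs.
From HB Require Import structures.
From mathcomp Require Import all_boot all_order all_algebra.
From mathcomp Require Import all_classical all_reals all_analysis.
From mathcomp Require Import ring lra.

Set Implicit Arguments.
Unset Strict Implicit.
Unset Printing Implicit Defensive.

Import Order.TTheory GRing.Theory Num.Theory.
Import numFieldNormedType.Exports.

Local Open Scope classical_set_scope.
Local Open Scope ring_scope.

(** Why the theorem is true.

    Let [x_k] converge weakly to [xbar] and write [D_k v] for the derivative of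
    [G (x_k)] at [v].  Concavity says that [G (x_k)] lies, in the order of the
    recession cone, below each of its tangents ([concave_below_tangent]); an
    element of [K] stays in [K] when the nonnegative gap to the tangent is added.

    Outer limits.  Let [y_k] be feasible for [x_k] and converge weakly to [y].
    The tangent at the fixed point [y] gives
    [G (x_k) y + D_k y (y_k - y) \in K].  The sequence [y_k] is bounded
    ([weak_cvg_bounded]) and [D_k y] converges in norm, so these elements of [K]
    converge weakly to [G xbar y]; a closed convex set is weakly closed
    ([closed_convex_weakly_closed]), for [K] as well as for [C].  Both facts rest
    on the separation of a point from a convex set ([separation]), obtained
    from the existence of a linear functional below a sublinear one
    ([hahn_banach]).

    Inner limits.  The heart is a Slater condition that is uniform in [k]
    ([uniform_slater]): for fixed [M] and [delta], and all large [k], every [v]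
    with [|v| < delta] has the form [G (x_k) w - z] with [w \in C] at distance at
    most [M] from [xbar], and [z \in K].  Given a feasible [y] for [xbar], the
    error [e_k = G (x_k) y - G xbar y] tends to 0; a convex combination of [y]
    with the Slater point that belongs to a multiple [v] of [- e_k] cancels the
    error, and the weight of the Slater point is of the order of [|e_k|]
    ([recovery_sequence]).

    The uniform Slater condition comes from the constraint qualification in three
    moves.  Baire's theorem turns the covering of a ball of [Y] by the linearized
    system into density in a ball of the values at bounded [c \in C]
    ([linearized_openness]).  Shrinking [c] towards [xbar] makes the tangent of
    [G (x_k)] at the shrunken point close to the linearization at [xbar],
    uniformly in [k], since [D_k v] is close to the derivative at [xbar] for large
    [k] and [v] near [xbar] ([derivative_uniformly_close]); as [G (x_k)] is
    compared with its tangent at that very point, concavity replaces the mean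
    value theorem.  This approximate covering becomes exact by the summation of a
    geometric series of errors in a closed convex graph ([convex_graph_range]). *)

(** * Linear functionals below sublinear ones *)

Definition sublinear (R : realType) (V : lmodType R) (q : V -> R) : Prop :=
  (forall x y, q (x + y) <= q x + q y) /\
  (forall t x, 0 < t -> q (t *: x) <= t * q x).

Section Sublinear.
Variables (R : realType) (V : lmodType R).
Implicit Types (p q : V -> R) (x y : V).

Lemma sublinear0 q : sublinear q -> q 0 = 0.
Proof.
move=> [_ qZ]; have := qZ 2 0 ltac:(lra); have := qZ 2^-1 0 ltac:(lra).
by rewrite !scaler0; lra.
Qed.

Lemma sublinearZ q t x : sublinear q -> 0 <= t -> q (t *: x) = t * q x.
Proof.
move=> sq; rewrite le_eqVlt => /predU1P[<-|t0].
  by rewrite scale0r mul0r sublinear0.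
apply/eqP; rewrite eq_le (proj2 sq)//= mulrC -ler_pdivlMr// mulrC.
rewrite -{1}[x](scalerK (lt0r_neq0 t0)); apply: (proj2 sq).
by rewrite invr_gt0.
Qed.

Lemma sublinearN q x : sublinear q -> - q (- x) <= q x.
Proof. by move=> sq; have := (proj1 sq) x (- x); rewrite subrr sublinear0//; lra. Qed.

(** The common construction behind [sublinear_tighten] and the chain step of
    Zorn's lemma: the family need only satisfy the two inequalities up to a
    change of index, and [b] keeps the infimum finite. *)
Lemma sublinear_inf (I : Type) (P : set I) (F : I -> V -> R) (b : V -> R) :
    P !=set0 -> (forall i x, P i -> b x <= F i x) ->
    (forall i j x y, P i -> P j ->
       exists2 k, P k & F k (x + y) <= F i x + F j y) ->
    (forall i (t : R) x, P i -> 0 < t -> exists2 k, P k & F k (t *: x) <= t * F i x) ->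
  let p x := inf [set F i x | i in P] in
  sublinear p /\ (forall i x, P i -> p x <= F i x).
Proof.
move=> [i0 Pi0] bF FD FZ p.
have pF i x : P i -> p x <= F i x.
  move=> Pi; apply: ge_inf; last by exists i.
  by exists (b x) => _ [j Pj <-]; exact: bF.
have lep x m : (forall i, P i -> m <= F i x) -> m <= p x.
  move=> mF; apply: lb_le_inf; first by exists (F i0 x), i0.
  by move=> _ [i Pi <-]; exact: mF.
split=> //; split=> [x y|t x t0].
  rewrite -lerBlDr; apply/lep => i Pi.
  rewrite lerBlDr -lerBlDl; apply/lep => j Pj.
  rewrite lerBlDl; have [k Pk] := FD _ _ x y Pi Pj.
  by apply: le_trans; exact: pF.
rewrite mulrC -ler_pdivrMr//; apply/lep => i Pi.
rewrite ler_pdivrMr// mulrC; have [k Pk] := FZ _ _ x Pi t0.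
by apply: le_trans; exact: pF.
Qed.

(** A sublinear functional can be lowered so as to obey the constraints
    [p w <= s], [(w, s)] in a convex cone [W], exactly when they are compatible with
    the bound [- q (- w) <= p w].  The witness is the infimal convolution
    [p x = inf (q (x - w) + s)].  Used to show that minimal functionals are
    linear and to separate a point from a convex set. *)
Lemma sublinear_tighten q (W : set (V * R)) : sublinear q -> W !=set0 ->
    (forall a b, W a -> W b -> W (a.1 + b.1, a.2 + b.2)) ->
    (forall t a, 0 < t -> W a -> W (t *: a.1, t * a.2)) ->
    (forall a, W a -> - a.2 <= q (- a.1)) ->
  exists p, [/\ sublinear p, forall x, p x <= q x & forall a, W a -> p a.1 <= a.2].
Proof.
move=> sq W0 WD WZ Wq.
pose F (a : V * R) x := q (x - a.1) + a.2.
have Fb a x : W a -> - q (- x) <= F a x.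
  move=> /Wq aq; rewrite /F.
  have := (proj1 sq) (x - a.1) (- x); rewrite addrAC subrr sub0r; lra.
have [||sp pF] := sublinear_inf W0 Fb.
- move=> a b x y Wa Wb; exists (a.1 + b.1, a.2 + b.2); first exact: WD.
  rewrite /F /=; have := (proj1 sq) (x - a.1) (y - b.1).
  by rewrite opprD addrACA; lra.
- move=> a t x Wa t0; exists (t *: a.1, t * a.2); first exact: WZ.
  by rewrite /F /= -scalerBr (sublinearZ _ sq (ltW t0)) mulrDr.
eexists; split; first exact: sp.
- move=> x; apply/ler_addgt0Pl => e e0.
  (* The vertex of the cone may be missing from W: approach it along a ray, by
     a factor t small enough to lose at most e. *)
  have [a Wa] := W0.
  pose t := e / (`|q (- a.1) + a.2| + 1).
  have t0 : 0 < t by rewrite divr_gt0// ltr_wpDl.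
  apply: le_trans (pF _ x (WZ _ _ t0 Wa)) _.
  rewrite /F /=; have := (proj1 sq) x (- (t *: a.1)).
  rewrite -scalerN (sublinearZ _ sq (ltW t0)).
  suff : t * (q (- a.1) + a.2) <= e by lra.
  rewrite /t mulrAC ler_pdivrMr ?ltr_wpDl// ler_pM2l//.
  by rewrite (le_trans (ler_norm _))// lerDl.
- move=> a Wa; apply: le_trans (pF _ a.1 Wa) _.
  by rewrite /F subrr (sublinear0 sq) add0r.
Qed.

Lemma exists_minimal_sublinear p : sublinear p ->
  exists f, [/\ sublinear f, forall x, f x <= p x &
    forall q, sublinear q -> (forall x, q x <= f x) -> q = f].
Proof.
move=> sp.
pose T := {q : V -> R | sublinear q /\ forall x, q x <= p x}.
pose below (s t : T) : bool := `[< forall x, sval t x <= sval s x >].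
have [||||[f [sf fp]] fmin] := @Zorn T below.
- by move=> t; apply/asboolP.
- move=> r s t /asboolP rs /asboolP st; apply/asboolP => x.
  exact: le_trans (st x) (rs x).
- move=> [s Ps] [t Pt] /asboolP /= st /asboolP /= ts.
  suff E : s = t by subst t; congr exist; exact: Prop_irrelevance.
  by apply/funext => x; apply: le_anti; rewrite st ts.
- move=> A Atot; have [->|/set0P A0] := eqVneq A set0.
    by exists (exist _ p (conj sp (fun x => lexx (p x)))) => s.
  have Ab (s : T) x : A s -> - p (- x) <= sval s x.
    move=> _; case: s => s [ss sp'] /=.
    by have := sublinearN x ss; have := sp' (- x); lra.
  have [||sq qF] := sublinear_inf A0 Ab.
  + move=> s t x y As At; have [/asboolP st|/asboolP ts] := Atot s t As At.
    * exists t => //; apply: le_trans (proj1 (proj1 (svalP t)) x y) _.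
      by rewrite lerD2r.
    * exists s => //; apply: le_trans (proj1 (proj1 (svalP s)) x y) _.
      by rewrite lerD2l.
  + by move=> s t x As t0; exists s => //; exact: (proj2 (proj1 (svalP s))).
  move: sq qF; set q := (fun x => inf _) => sq qF.
  have qp x : q x <= p x.
    have [s As] := A0; exact: le_trans (qF _ x As) (proj2 (svalP s) x).
  exists (exist _ q (conj sq qp)) => s As.
  by apply/asboolP => x; exact: qF.
exists f; split=> // q sq qf.
have qp x : q x <= p x by exact: le_trans (qf x) (fp x).
by have [] := fmin (exist _ q (conj sq qp)) ltac:(exact/asboolP).
Qed.

(** A minimal sublinear functional [f] is odd, hence linear: constraining it
    further along the ray of [- v] by [f (- v) <= - f v] is always possible, so by
    minimality this inequality already holds. *)
Lemma hahn_banach p : sublinear p ->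
  exists f : {linear V -> R^o}, forall x, f x <= p x.
Proof.
move=> /exists_minimal_sublinear[f [sf fp fmin]].
have fN v : f (- v) = - f v.
  pose W : set (V * R) := [set a | exists2 t, 0 <= t & a = (t *: - v, - (t * f v))].
  have [||||g [sg gf gW]] := @sublinear_tighten f W sf.
  - by exists (0 *: - v, - (0 * f v)), 0.
  - move=> _ _ [s s0 ->] [t t0 ->]; exists (s + t); first exact: addr_ge0.
    by rewrite /= scalerDl mulrDl opprD.
  - move=> t _ t0 [s s0 ->]; exists (t * s); first by rewrite mulr_ge0// ltW.
    by rewrite /= scalerA mulrN mulrA.
  - by move=> _ [t t0 ->] /=; rewrite opprK scalerN opprK (sublinearZ _ sf t0).
  have := gW (1 *: - v, - (1 * f v)) ltac:(by exists 1).
  rewrite (fmin g sg gf) /= scale1r mul1r.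
  by have := sublinearN v sf; lra.
have fD x y : f (x + y) = f x + f y.
  have := (proj1 sf) x y; have := (proj1 sf) (x + y) (- y).
  by rewrite addrK fN; lra.
have fZ t x : f (t *: x) = t * f x.
  have [t0|t0] := leP 0 t; first exact: sublinearZ.
  rewrite -[t]opprK scaleNr fN (sublinearZ _ sf) ?oppr_ge0 ?ltW//.
  by rewrite !mulNr.
have lf : linear (f : V -> R^o) by move=> a x y; rewrite fD fZ.
pose F : {linear V -> R^o} := HB.pack (f : V -> R^o)
  (GRing.isLinear.Build _ _ _ _ (f : V -> R^o) lf).
exists F => x; exact: fp.
Qed.

End Sublinear.

(** * Separation and weakly closed convex sets *)

Section Separation.
Variable R : realType.

Lemma convex_set_combination (V : lmodType R) (A : set V) (a : R) (x y : V) :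
  convex_set A -> 0 <= a <= 1 -> A x -> A y -> A (a *: x + (1 - a) *: y).
Proof.
move=> cA /andP[a0 a1] Ax Ay.
by have := cA x y (Itv01 a0 a1); rewrite !inE; apply.
Qed.

Lemma convex_set_of_combinations (V : lmodType R) (A : set V) :
  (forall x y (a : R), 0 <= a <= 1 -> A x -> A y -> A (a *: x + (1 - a) *: y)) ->
  convex_set A.
Proof.
by move=> cA x y l; rewrite !inE => Ax Ay; apply: cA => //; rewrite ge0 le1.
Qed.

Lemma convex_combB (V : lmodType R) (a : R) (c c' x : V) :
  a *: c + (1 - a) *: c' - x = a *: (c - x) + (1 - a) *: (c' - x).
Proof. by rewrite !scalerBr [RHS]addrACA -opprD -scalerDl (addrC a) subrK scale1r. Qed.

Lemma convex_comb_dist (V : normedModType R) (a M : R) (c c' x : V) :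
    0 <= a <= 1 -> `|c - x| <= M -> `|c' - x| <= M ->
  `|a *: c + (1 - a) *: c' - x| <= M.
Proof.
move=> /andP[a0 a1] cM cM'; have b0 : 0 <= 1 - a by lra.
rewrite convex_combB (le_trans (ler_normD _ _))// !normrZ !ger0_norm//.
by have := ler_wpM2l a0 cM; have := ler_wpM2l b0 cM'; lra.
Qed.

Lemma bounded_linearP (V W : normedModType R) (f : {linear V -> W}) :
  (exists M : R, forall x, `|f x| <= M * `|x|) <-> continuous f.
Proof.
split=> [[M fM]|/(_ 0)/continuous_linear_bounded/linear_boundedP].
  apply: bounded_linear_continuous; apply/linear_boundedP.
  exists M; split=> [|r Mr x]; first exact: num_real.
  by apply: le_trans (fM x) _; rewrite ler_wpM2r// ltW.
by move=> /pinfty_ex_gt0[M _ fM]; exists M.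
Qed.

(** Tightening the norm by [f (k - u) <= - d] for all [k] in [K], and along the cone
    that these pairs span; compatibility is the hypothesis that [u] has distance
    at least [d] from [K].  Dominance by the norm makes [f] continuous. *)
Lemma separation (V : normedModType R) (K : set V) (u : V) (d : R) :
    convex_set K -> K !=set0 -> (forall k, K k -> d <= `|u - k|) ->
  exists f : {linear V -> R^o},
    (forall x, `|f x : R| <= `|x|) /\ (forall k, K k -> (f k : R) <= f u - d).
Proof.
move=> cK [k0 Kk0] du.
pose W : set (V * R) := [set a | exists2 t : R, 0 < t &
  exists2 k, K k & a = (t *: (k - u), - (t * d))].
have snorm : sublinear (fun x : V => `|x| : R).
  by split=> [x y|t x t0]; [exact: ler_normD|rewrite normrZ gtr0_norm].
have [||||p [sp pn pW]] := @sublinear_tighten _ V _ W snorm.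
- by exists (1 *: (k0 - u), - (1 * d)), 1 => //; exists k0.
- move=> _ _ [s s0 [k Kk ->]] [t t0 [l Kl ->]] /=.
  have st0 : 0 < s + t by exact: addr_gt0.
  (* s (k - u) + t (l - u) is s + t times (m - u), with m the barycentre of k, l. *)
  exists (s + t) => //; exists (s / (s + t) *: k + (1 - s / (s + t)) *: l).
    apply: convex_set_combination => //; rewrite divr_ge0 ?(ltW s0) ?(ltW st0)//=.
    by rewrite ler_pdivrMr// mul1r lerDl ltW.
  congr pair; last by ring.
  have st : (s + t) * (1 - s / (s + t)) = t by field; rewrite gt_eqF.
  rewrite !scalerBr scalerDr !scalerA st mulrCA divff ?gt_eqF// mulr1.
  by rewrite scalerDl opprD addrACA.
- move=> t _ t0 [s s0 [k Kk ->]]; exists (t * s); first exact: mulr_gt0.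
  by exists k => //=; rewrite scalerA mulrN mulrA.
- move=> _ [t t0 [k Kk ->]] /=; rewrite opprK -scalerN opprB normrZ gtr0_norm//.
  by rewrite ler_pM2l// du.
have [f fp] := hahn_banach sp.
exists f; split=> [x|k Kk].
  rewrite ler_norml (le_trans (fp x) (pn x)) andbT.
  by have := le_trans (fp (- x)) (pn (- x)); rewrite normrN linearN /=; lra.
have W1 : W (k - u, - d) by exists 1 => //; exists k => //; rewrite scale1r mul1r.
by have := le_trans (fp (k - u)) (pW _ W1); rewrite linearB/=; lra.
Qed.

(** Separation of [u] from the convex set [{0}]. *)
Lemma norming_functional (V : normedModType R) (u : V) :
  exists f : {linear V -> R^o},
    (forall x, `|f x : R| <= `|x|) /\ (`|u| <= f u :> R).
Proof.
have [||k ->|f [fn fu]] := @separation V [set 0] u `|u|.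
- move=> x y a; rewrite !inE /= => -> ->; exact: (@convmm R (convex_lmodType V) a 0).
- by exists 0.
- by rewrite subr0.
by exists f; split => //; have := fu 0 erefl; rewrite linear0; lra.
Qed.

Lemma closed_convex_weakly_closed (V : normedModType R) (K : set V)
    (u : nat -> V) (l : V) :
  closed K -> convex_set K -> (forall n, K (u n)) -> weak_cvg u l -> K l.
Proof.
move=> clK cK Ku ul; apply: contrapT => Kl.
have [d d0 ld] : exists2 d : R, 0 < d & forall k, K k -> d <= `|l - k|.
  have /nbhs_normP[d /= d0 dK] : nbhs l (~` K).
    by apply: open_nbhs_nbhs; split=> //; exact: closed_openC.
  exists d => // k Kk; rewrite leNgt; apply/negP => lk.
  exact: (dK k).
have [f [fn fK]] := separation cK (ex_intro _ _ (Ku 0%N)) ld.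
have fc : continuous f by apply/bounded_linearP; exists 1 => x; rewrite mul1r.
have /cvgrPdist_lt/(_ d d0)[N _ /(_ N (leqnn N))/=] := ul f fc.
rewrite ltNge => /negP; apply; apply: le_trans (ler_norm _).
by have := fK _ (Ku N); lra.
Qed.

End Separation.

(** * Weakly convergent sequences are bounded *)

Section UniformBoundedness.
Variable R : realType.

Lemma geometric_cvg (V : completeNormedModType R) (z : nat -> V) (M q : R) :
    0 <= q < 1 -> (forall n, `|z n.+1 - z n| <= M * q ^+ n) ->
  exists2 l, z @ \oo --> l & forall n, `|l - z n| <= M / (1 - q) * q ^+ n.
Proof.
move=> /andP[q0 q1] zq.
have zmn n m : `|z (n + m)%N - z n| <= M / (1 - q) * (q ^+ n - q ^+ (n + m)).
  elim: m => [|m IH]; first by rewrite addn0 !subrr normr0 mulr0.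
  rewrite -[X in `|X|](subrKA (z (n + m)%N)) addrC.
  apply: le_trans (ler_normD _ _) _.
  have := zq (n + m)%N; rewrite -addnS => zS.
  suff : M * q ^+ (n + m) = M / (1 - q) * (q ^+ (n + m) - q ^+ (n + m.+1)) by lra.
  rewrite addnS exprS; field; lra.
have M0 : 0 <= M by have := zq 0%N; rewrite expr0 mulr1; exact: le_trans.
have Mq0 : 0 <= M / (1 - q) by rewrite divr_ge0// subr_ge0 ltW.
have zmn' n m : `|z (n + m)%N - z n| <= M / (1 - q) * q ^+ n.
  apply: le_trans (zmn n m) _; rewrite ler_wpM2l// gerDl oppr_le0.
  exact: exprn_ge0.
have zcvg : cvg (z @ \oo).
  have : cvg (series (fun n => z n.+1 - z n) @ \oo).
    apply: normed_cvg; apply: (@series_le_cvg _ _ (geometric M q)) => [n|n|n|].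
    - exact: normr_ge0.
    - by rewrite /geometric /= mulr_ge0// exprn_ge0.
    - exact: zq.
    - by apply: is_cvg_geometric_series; rewrite ger0_norm.
  move=> sc; have : cvg ((fun n => series (fun n => z n.+1 - z n) n + z 0%N) @ \oo).
    by apply: is_cvgD => //; exact: is_cvg_cst.
  by congr (cvg (_ @ \oo)); apply/funext => n; rewrite /series /= telescope_sumr// subrK.
exists (lim (z @ \oo)) => // n; apply/ler_addgt0Pr => e e0.
have /cvgrPdist_lt/(_ e e0)[N _ zN] := zcvg.
have := zN (n + N)%N (leq_addl _ _); have := zmn' n N => /=.
rewrite -[X in _ -> _ -> `|X| <= _](subrKA (z (n + N)%N)).
by have := ler_normD (lim (z @ \oo) - z (n + N)%N) (z (n + N)%N - z n); lra.
Qed.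

(** Gliding hump: if the norms were unbounded, a continuous functional unbounded
    along the sequence would exist.  It is the sum of norming functionals [h n] of
    points of rapidly growing norm, with weights [3^-n] and signs chosen one after
    the other: the [n]-th term adds up constructively with the partial sum before
    it, and all the later terms together weigh only half as much. *)
Lemma weak_cvg_bounded (V : normedModType R) (u : nat -> V) (l : V) :
  weak_cvg u l -> exists M : R, forall n, `|u n| <= M.
Proof.
move=> ul; apply: contrapT => /forallNP ub.
have {}ub (n : nat) : exists k, 2 * n%:R * 3 ^+ n < `|u k|.
  apply: contrapT => /forallNP uk; apply: (ub (2 * n%:R * 3 ^+ n)) => k.
  by rewrite leNgt; exact/negP.
(* 3^n compensates the weight of the n-th term and 2 the tail, so that the
   functional will exceed n at the n-th point. *)
have [k {}ub] := choice ub.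
have [h hP] := choice (fun n => norming_functional (u (k n))).
pose q : R := 3^-1.
have q01 : 0 <= q < 1 by rewrite /q; lra.
have q0 n : 0 < q ^+ n by rewrite exprn_gt0// /q; lra.
pose s n (g : V -> R) : R := if 0 <= g (u (k n)) then 1 else -1.
pose g n : V -> R^o :=
  iteri n (fun i g x => g x + s i g * q ^+ i * (h i x : R)) (fun _ => 0).
have gS n x : g n.+1 x = (g n x : R) + s n (g n) * q ^+ n * (h n x : R) by [].
have s1 n v : `|s n v| = 1 by rewrite /s; case: ifP; rewrite ?normrN normr1.
have gdist x n : `|g n.+1 x - g n x| <= `|x| * q ^+ n.
  rewrite gS addrAC subrr add0r !normrM s1 mul1r (gtr0_norm (q0 n)) mulrC.
  by rewrite ler_pM2r//; exact: (proj1 (hP n)).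
have ggrow n : q ^+ n * `|u (k n)| <= `|g n.+1 (u (k n)) : R|.
  have [_ hn] := hP n; have : q ^+ n * `|u (k n)| <= q ^+ n * (h n (u (k n)) : R).
    by rewrite ler_pM2l.
  rewrite gS /s => H; case: ifPn => [g0|]; last rewrite -ltNge => g0.
    by apply: le_trans (ler_norm _); lra.
  by rewrite -[leRHS]normrN; apply: le_trans (ler_norm _); lra.
have /choice[G GP] x : exists y : R^o, (fun n => g n x) @ \oo --> y /\
    forall n, `|y - g n x| <= `|x| / (1 - q) * q ^+ n.
  by have [y gy yg] := geometric_cvg q01 (gdist x); exists y.
have glin n : linear (g n).
  move=> a x y; elim: n => [|n IH]; first by rewrite /= scaler0 addr0.
  by rewrite !gS IH linearP /= /GRing.scale /=; ring.
have Glin : linear G.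
  move=> a x y.
  have gxy : (fun n => g n (a *: x + y)) @ \oo --> a *: G x + G y.
    under eq_fun do rewrite glin.
    by apply: cvgD; [apply: cvgZl_tmp|]; exact: (proj1 (GP _)).
  exact: (cvg_unique (@norm_hausdorff _ _) (proj1 (GP _)) gxy).
pose F : {linear V -> R^o} := HB.pack G (GRing.isLinear.Build _ _ _ _ G Glin).
have Fc : continuous F.
  apply/bounded_linearP; exists (1 - q)^-1 => x.
  have := proj2 (GP x) 0%N; rewrite expr0 mulr1 /= subr0.
  by rewrite mulrC.
have /cvg_seq_bounded : cvg ((fun n => F (u n)) @ \oo) by apply/cvg_ex; exists (F l); exact: ul.
move=> /pinfty_ex_gt0[M M0 /= FM].
pose n := (Num.truncn M).+1.
have Mn : M < n%:R by rewrite /n truncnS_gt.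
have a0 := q0 n; have ab : q ^+ n * 3 ^+ n = 1 by rewrite -exprMn mulVf// expr1n.
have := ub n; rewrite -(ltr_pM2l a0).
rewrite (_ : q ^+ n * _ = 2 * n%:R * (q ^+ n * 3 ^+ n)); last by ring.
rewrite ab mulr1 => big.
have := proj2 (GP (u (k n))) n.+1.
rewrite (_ : _ / _ * _ = q ^+ n * `|u (k n)| / 2); last first.
  by rewrite exprS /q; field; lra.
have := ler_normB (G (u (k n)) : R) (G (u (k n)) - g n.+1 (u (k n))).
rewrite subKr; have := ggrow n; have := FM (k n) I => /=.
by lra.
Qed.

End UniformBoundedness.

(** * Limits of sequences *)

Section Sequences.
Variable R : realType.

Lemma closed_seq_limit (V : normedModType R) (A : set V) (u : nat -> V) (l : V) :
  closed A -> (forall n, A (u n)) -> u @ \oo --> l -> A l.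
Proof. by move=> cA Au; apply: (closed_cvg _ cA); exact: nearW. Qed.

Lemma cvg_of_dist (V : normedModType R) (u : nat -> V) (l : V) (c : nat -> R) :
  (\forall n \near \oo, `|u n - l| <= c n) -> c @ \oo --> 0 -> u @ \oo --> l.
Proof.
move=> uc c0; apply/cvgrPdist_lt => e e0; move/cvgrPdist_lt: c0 => /(_ e e0).
apply: filterS2 uc => n unc; rewrite sub0r normrN => cne.
by rewrite distrC (le_lt_trans unc)// (le_lt_trans (ler_norm _)).
Qed.

End Sequences.

(** * Concave maps lie below their tangents *)

Section Concavity.
Variable R : realType.

Lemma recession_coneD (Y : normedModType R) (K : set Y) (y z : Y) :
  recession_cone K y -> K z -> K (y + z).
Proof. by move=> yK Kz; apply: yK; exists z. Qed.

Lemma recession_cone_natmul (Y : normedModType R) (K : set Y) (y : Y) n :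
  recession_cone K y -> recession_cone K (n%:R *: y).
Proof.
move=> yK; elim: n => [|n IH] _ [z Kz <-]; first by rewrite scale0r add0r.
rewrite -natr1 scalerDl scale1r [X in X + z]addrC -addrA.
by apply: recession_coneD => //; apply: IH; exists z.
Qed.

(** Concavity bounds the difference quotients of [f] at [y1] from below by
    [f y2 - f y1], and the closedness of [K] passes this on to their limit.  With
    step [1 / (n + 1)] the gap is an integer multiple of the concavity defect, so
    that the stability of the recession cone under addition suffices. *)
Lemma concave_below_tangent (X Y : normedModType R) (K : set Y) (f : X -> Y)
    (y1 y2 : X) :
    closed K -> differentiable f y1 ->
    (forall a : R, 0 <= a <= 1 -> recession_cone K
       (f ((1 - a) *: y1 + a *: y2) - (1 - a) *: f y1 - a *: f y2)) ->
  recession_cone K (f y1 + 'd f y1 (y2 - y1) - f y2).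
Proof.
move=> clK df fconc _ [z Kz <-].
have dcvg := @diff_derivable _ _ _ _ _ (y2 - y1) df.
have := deriveE (y2 - y1) df; rewrite /derive => dE.
have {}dcvg : h^-1 *: ((f \o shift y1) (h *: (y2 - y1)) - f y1) @[h --> 0^']
    --> 'd f y1 (y2 - y1) by rewrite -dE.
have {}dcvg : n.+1%:R *: (f (n.+1%:R^-1 *: (y2 - y1) + y1) - f y1) @[n --> \oo]
    --> 'd f y1 (y2 - y1).
  apply/cvgrPdist_le => e e0; move/cvgrPdist_le: dcvg => /(_ e e0)[r /= r0 H].
  have /cvgrPdist_lt/(_ r r0)[N _ hN] := @cvg_harmonic R.
  exists N => // n Nn /=; have := H n.+1%:R^-1; rewrite invrK; apply.
    exact: (hN n Nn).
  by rewrite gt_eqF.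
have uK n : K (n.+1%:R *: (f (n.+1%:R^-1 *: (y2 - y1) + y1) - f y1) + (f y1 - f y2 + z)).
  pose a : R := n.+1%:R^-1.
  have na : n.+1%:R * a = 1 by rewrite mulfV.
  have a01 : 0 <= a <= 1 by rewrite invr_ge0 ler0n/= invf_le1// ler1n.
  have := recession_coneD (recession_cone_natmul (n := n.+1) (fconc a a01)) Kz.
  have -> : (1 - a) *: y1 + a *: y2 = a *: (y2 - y1) + y1.
    by rewrite scalerBl scale1r scalerBr [LHS]addrAC [RHS]addrAC (addrC y1).
  congr (K _); rewrite addrA; congr (_ + z).
  rewrite scalerBl scale1r !scalerBr !scalerA na !scale1r.
  by rewrite opprB !addrA; congr (_ - _); rewrite addrAC.
suff : K ('d f y1 (y2 - y1) + (f y1 - f y2 + z)).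
  by congr (K _); rewrite addrA; congr (_ + z); rewrite addrCA addrA.
apply: (closed_seq_limit clK uK).
exact: cvgD dcvg (cvg_cst _).
Qed.

End Concavity.

(** * Openness of multimaps with convex graph *)

Section OpenMapping.
Variable R : realType.

(** By Baire's theorem the closure of some [A n] contains a ball around some [x0].  A
    small negative multiple of [x0] is covered too; convex combinations with that
    point move the ball to the origin. *)
Lemma baire_convex_union (Y : completeNormedModType R) (A : nat -> set Y) (rho : R) :
    0 < rho -> (forall n, convex_set (A n)) ->
    (forall m n, (m <= n)%N -> A m `<=` A n) ->
    (forall y, `|y| < rho -> exists n, A n y) ->
  exists n, exists2 eta : R, 0 < eta &
    forall y e, `|y| < eta -> 0 < e -> exists2 a, A n a & `|y - a| < e.
Proof.
move=> rho0 cA Amono Acov.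
have closureE n y e : closure (A n) y -> 0 < e -> exists2 a, A n a & `|y - a| < e.
  move=> /(_ (ball y e)) cAy e0; have [|a [Aa]] := cAy; first exact: nbhsx_ballx.
  by rewrite -ball_normE /= => ya; exists a.
have [n nd] : exists n, ~ dense (~` closure (A n)).
  apply: contrapT => /forallNP H.
  have bD : dense (\bigcap_n ~` closure (A n)).
    apply: Baire => n; split; first exact/closed_openC/closed_closure.
    exact: contrapT (H n).
  have [||y []] := bD (ball (0 : Y) rho).
  - by exists 0; exact: ballxx.
  - exact: ball_open.
  - rewrite -ball_normE /= sub0r normrN => /Acov[n Any] /(_ n I); apply.
    exact: subset_closure.
have [x0 [r r0 xr]] : exists x0, exists2 r : R, 0 < r &
    forall y, `|x0 - y| < r -> closure (A n) y.
  have [U [[x Ux] UA]] := denseNE nd.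
  have /nbhs_normP[r /= r0 xr] := open_nbhs_nbhs Ux.
  exists x, r => // y xy; apply: contrapT => Ay.
  have : (U `&` ~` closure (A n)) y by split=> //; exact: xr.
  by rewrite UA.
pose lam := rho / (2 * (`|x0| + 1)).
have x01 : 0 < `|x0| + 1 by rewrite ltr_wpDl.
have lam0 : 0 < lam by rewrite divr_gt0// mulr_gt0.
have [|m Am] := Acov (- lam *: x0).
  rewrite normrZ normrN gtr0_norm// /lam.
  rewrite mulrAC ltr_pdivrMr ?mulr_gt0// ltr_pM2l//.
  by have := normr_ge0 x0; lra.
exists (maxn n m), (lam * r / (1 + lam)).
  by rewrite divr_gt0 ?mulr_gt0// addr_gt0.
move=> y e ye e0.
have l1 : 0 < 1 + lam by rewrite addr_gt0.
pose p := x0 + ((1 + lam) / lam) *: y.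
have [|a Aa pa] := @closureE n p e _ e0.
  apply: xr; rewrite opprD addrA subrr sub0r normrN normrZ gtr0_norm ?divr_gt0//.
  rewrite mulrC -ltr_pdivlMr ?divr_gt0//; apply: lt_le_trans ye _.
  by rewrite le_eqVlt; apply/orP; left; apply/eqP; field; rewrite !gt_eqF.
pose mu := (1 + lam)^-1.
have mu01 : 0 < mu < 1 by rewrite /mu invr_gt0 l1 invf_lt1//; lra.
exists (mu *: (- lam *: x0) + (1 - mu) *: a).
  apply: convex_set_combination; [exact: cA| |exact: Amono (leq_maxr _ _) _ Am|].
    by case/andP: mu01 => *; rewrite !ltW.
  exact: Amono (leq_maxl _ _) _ Aa.
have -> : y - (mu *: (- lam *: x0) + (1 - mu) *: a) = (1 - mu) *: (p - a).
  rewrite /p opprD addrA scalerBr; congr (_ - _).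
  rewrite scalerDr !scalerA mulrN scaleNr opprK addrC.
  have -> : (1 - mu) = mu * lam by rewrite /mu; field; rewrite gt_eqF.
  congr (_ + _); rewrite -[LHS]scale1r; congr (_ *: _).
  by rewrite /mu; field; rewrite !gt_eqF.
rewrite normrZ gtr0_norm; last lra.
by apply: le_lt_trans pa; rewrite ler_piMl//; lra.
Qed.

(** The Robinson-Ursescu argument.  If [y] is approximated by [y'] in the range up to
    half a radius, the doubled error is again approximable, and so on: [y] becomes
    the series of the [2^-(i+1) y'_i], a convex combination of points of the range.
    Over a bounded domain the corresponding combinations of the [x_i] converge, and
    the graph is closed. *)
Lemma convex_graph_range (X Y : completeNormedModType R)
    (Gr : X -> Y -> Prop) (x0 : X) (M rho : R) :
    (forall x x' y y' (a : R), 0 <= a <= 1 -> Gr x y -> Gr x' y' ->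
       Gr (a *: x + (1 - a) *: x') (a *: y + (1 - a) *: y')) ->
    (forall (x_ : nat -> X) (y_ : nat -> Y) x y,
       (forall n, Gr (x_ n) (y_ n)) -> x_ @ \oo --> x -> y_ @ \oo --> y -> Gr x y) ->
    (forall x y, Gr x y -> `|x - x0| <= M) ->
    (forall y, `|y| < rho -> exists x y', Gr x y' /\ `|y - y'| < rho / 2) ->
  forall y, `|y| < rho / 2 -> exists x, Gr x y.
Proof.
move=> cvx clo bnd app y yrho.
have /choice[f fP] (v : Y) : exists p : X * Y, `|v| < rho / 2 ->
    Gr p.1 p.2 /\ `|2 *: v - p.2| < rho / 2.
  have [vr|vr] := pselect (`|v| < rho / 2); last by exists (0, 0).
  have [|x [y' [Gxy vy]]] := app (2 *: v); last by exists (x, y').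
  by rewrite normrZ gtr0_norm//; lra.
pose r n : Y := iter n (fun v => 2 *: v - (f v).2) y.
have rS n : r n.+1 = 2 *: r n - (f (r n)).2 by [].
have rb n : `|r n| < rho / 2.
  by elim: n => [|n IH] //; rewrite rS; have [] := fP _ IH.
pose x n := (f (r n)).1; pose a n := (f (r n)).2.
have Ga n : Gr (x n) (a n) by have [] := fP _ (rb n).
pose q : R := 2^-1.
pose X_ n : X := \sum_(i < n) q ^+ i.+1 *: x i.
pose Y_ n : Y := \sum_(i < n) q ^+ i.+1 *: a i.
have XS n : X_ n.+1 = X_ n + q ^+ n.+1 *: x n by rewrite /X_ big_ord_recr.
have YS n : Y_ n.+1 = Y_ n + q ^+ n.+1 *: a n by rewrite /Y_ big_ord_recr.
(* The partial sums lack the weight 2^-n, to be given to any point of the graph. *)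
have partial n u v : Gr u v -> Gr (X_ n + q ^+ n *: u) (Y_ n + q ^+ n *: v).
  elim: n u v => [|n IH] u v Guv.
    by rewrite /X_ /Y_ !big_ord0 !add0r !scale1r.
  rewrite XS YS -!addrA exprSr -!scalerA -!scalerDr.
  apply: IH; rewrite !scalerDr (_ : q *: u = (1 - q) *: u); last first.
    by congr (_ *: _); rewrite /q; lra.
  rewrite (_ : q *: v = (1 - q) *: v); last by congr (_ *: _); rewrite /q; lra.
  by apply: cvx => //; rewrite /q; lra.
pose w n := X_ n + q ^+ n *: x n; pose b n := Y_ n + q ^+ n *: a n.
have Gwb n : Gr (w n) (b n) by exact: partial.
have q01 : 0 <= q < 1 by rewrite /q; lra.
have q0 n : 0 < q ^+ n by rewrite exprn_gt0// /q; lra.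
have [l wl _] : exists2 l, w @ \oo --> l & forall n, `|l - w n| <= M / (1 - q) * q ^+ n.
  apply: geometric_cvg => // n.
  rewrite /w XS (_ : _ - _ = q ^+ n.+1 *: (x n.+1 - x n)); last first.
    rewrite scalerBr.
    have -> : q ^+ n *: x n = q ^+ n.+1 *: x n + q ^+ n.+1 *: x n.
      by rewrite -scalerDl; congr (_ *: _); rewrite exprS /q; field.
    rewrite -(addrA (X_ n) _ (_ *: x n.+1)) opprD addrACA subrr add0r.
    by rewrite opprD addrACA subrr add0r.
  rewrite normrZ gtr0_norm//.
  have := bnd _ _ (Ga n); have := bnd _ _ (Ga n.+1).
  have := ler_normB (x n.+1 - x0) (x n - x0); rewrite opprB addrA subrK => H1 H2 H3.
  by rewrite exprS mulrAC ler_pM2r// /q; lra.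
exists l; apply: clo Gwb wl _.
have Yr n : Y_ n = y - q ^+ n *: r n.
  elim: n => [|n IH]; first by rewrite /Y_ big_ord0 /r /= scale1r subrr.
  rewrite YS IH rS scalerBr opprB addrA scalerA exprSr -mulrA mulVf// mulr1.
  by rewrite addrAC.
have bE : b = (fun n => y + q ^+ n *: (a n - r n)).
  by apply/funext => n; rewrite /b Yr scalerBr addrA addrAC.
have ar n : `|a n - r n| <= 2 * rho.
  have := fP _ (rb n); rewrite -/(a n) => -[_].
  have := ler_distD (2 *: r n) (a n) (r n).
  have -> : 2 *: r n - r n = r n by rewrite scaler_nat mulr2n addrK.
  rewrite [`|a n - 2 *: _|]distrC.
  by have := rb n; have := normr_ge0 (r n); lra.
apply: (cvg_of_dist (c := fun n => q ^+ n * (2 * rho))).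
  apply: nearW => n; rewrite bE addrAC subrr add0r normrZ gtr0_norm//.
  by rewrite ler_pM2l// ar.
rewrite -(mul0r (2 * rho)); apply: cvgMr_tmp; apply: cvg_expr.
by rewrite ger0_norm /q; lra.
Qed.

End OpenMapping.

(** * Weak convergence and operator norms *)

Section WeakConvergence.
Variable R : realType.

Lemma cvg_infty_of_ge (phi : nat -> nat) :
  (forall n, (n <= phi n)%N) -> phi @ \oo --> \oo.
Proof.
move=> phin A [N _ NA]; exists N => // n Nn; apply: NA.
exact: leq_trans (phin n).
Qed.

Lemma weak_cvg_comp (V : normedModType R) (u : nat -> V) (l : V) (phi : nat -> nat) :
  phi @ \oo --> \oo -> weak_cvg u l -> weak_cvg (u \o phi) l.
Proof. by move=> phioo ul f fc; apply: cvg_comp phioo (ul f fc). Qed.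

Lemma operator_norm_ge0 (V W : normedModType R) (T : V -> W) :
  0 <= operator_norm T.
Proof.
rewrite /operator_norm; set S := (X in sup X).
have [S_sup|/sup_out->//] := pselect (has_sup S).
apply: le_trans (normr_ge0 (T 0)) _; apply: sup_upper_bound => //.
by exists 0; rewrite //= normr0.
Qed.

Lemma le_operator_norm (V W : normedModType R) (T : {linear V -> W}) (h : V) :
  continuous T -> `|T h| <= operator_norm T * `|h|.
Proof.
move=> /bounded_linearP[M TM].
have Tsup v : `|v| <= 1 -> `|T v| <= operator_norm T.
  move=> v1; apply: sup_upper_bound; last by exists v.
  split; first by exists `|T v|, v.
  exists (`|M|) => _ [w w1 <-]; apply: le_trans (TM w) _.
  apply: le_trans (ler_norm _) _; rewrite normrM normr_id.
  by rewrite ler_piMr.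
have [->|h0] := eqVneq h 0; first by rewrite linear0 !normr0 mulr0.
have h0' : 0 < `|h| by rewrite normr_gt0.
rewrite -ler_pdivrMr//.
have := Tsup (`|h|^-1 *: h); rewrite linearZ/= !normrZ normfV normr_id mulVf ?gt_eqF//.
by rewrite mulrC; apply.
Qed.

Lemma le_operator_norm_sub (V W : normedModType R) (S T : {linear V -> W}) (h : V) :
    continuous S -> continuous T ->
  `|S h - T h| <= operator_norm (fun h => S h - T h) * `|h|.
Proof.
move=> Sc Tc; apply: (le_operator_norm (T := (S \- T : {linear V -> W}))).
by move=> x; apply: cvgB; [exact: Sc|exact: Tc].
Qed.

End WeakConvergence.

(** * Limits of feasible points *)

Section ConstraintSystem.
Variables (R : realType) (X Y : completeNormedModType R).
Variables (C : set X) (K : set Y) (G : X -> X -> Y).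
Hypotheses (C_convex : convex_set C) (C_closed : closed C).
Hypotheses (K_convex : convex_set K) (K_closed : closed K).
Hypothesis G_diff : forall x y : X, differentiable (G x) y.
Hypothesis G_concave : concave_wrt_snd (recession_cone K) G.
Hypothesis G_cont : forall (x y : X) (x_ y_ : nat -> X),
  weak_cvg x_ x -> y_ @ \oo --> y ->
  G (x_ k) (y_ k) @[k --> \oo] --> G x y /\
  operator_cvg (fun k => 'd (G (x_ k)) (y_ k)) ('d (G x) y).

Let dG_cont x y : continuous ('d (G x) y).
Proof. exact: diff_continuous. Qed.

(** The form in which concavity is used: in a membership in [K] the value
    [G x y2] may be replaced by that at [y2] of any tangent. *)
Lemma below_tangent x y1 y2 k :
  K (G x y2 + k) -> K (G x y1 + 'd (G x) y1 (y2 - y1) + k).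
Proof.
move=> Kk.
have tgt : recession_cone K (G x y1 + 'd (G x) y1 (y2 - y1) - G x y2).
  by apply: concave_below_tangent => // a a01; exact: G_concave.
by have := recession_coneD tgt Kk; rewrite addrA subrK.
Qed.

(** The values [z k] at [y_ k] of the tangents at the limit point [y] lie in [K] and
    converge weakly to [G x y]. *)
Lemma weak_limit_feasible (x_ y_ : nat -> X) (x y : X) :
    weak_cvg x_ x -> weak_cvg y_ y -> (forall k, K (G (x_ k) (y_ k))) ->
  K (G x y).
Proof.
move=> xx yy Kxy.
pose z k := G (x_ k) y + 'd (G (x_ k)) y (y_ k - y).
apply: (closed_convex_weakly_closed K_closed K_convex (u := z)).
  move=> k; have := @below_tangent (x_ k) y (y_ k) 0.
  by rewrite !addr0; apply.
have [Gcvg Dcvg] := G_cont xx (cvg_cst y : (fun _ : nat => y) @ \oo --> y).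
have [M yM] := weak_cvg_bounded yy.
have Dh0 : 'd (G (x_ k)) y (y_ k - y) - 'd (G x) y (y_ k - y) @[k --> \oo] --> 0.
  apply: (cvg_of_dist (c := fun k => operator_norm
    (fun h => 'd (G (x_ k)) y h - 'd (G x) y h) * (M + `|y|))).
    apply: nearW => k; rewrite subr0.
    have := @le_operator_norm_sub R X Y ('d (G (x_ k)) y) ('d (G x) y)
      (y_ k - y) (@dG_cont _ _) (@dG_cont _ _).
    move=> /le_trans; apply.
    rewrite ler_pM ?ler_norm//; last by rewrite (le_trans (ler_normB _ _))// lerD2r.
    exact: operator_norm_ge0.
  by rewrite -(mul0r (M + `|y|)); apply: cvgMr_tmp; exact: Dcvg.
(* Against a functional f the tangent value splits into a strongly convergent
   part, the vanishing part just treated, and f o D at y_ k - y. *)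
move=> f fc.
have fG : f (G (x_ k) y) @[k --> \oo] --> f (G x y).
  by apply: continuous_cvg => //; exact: fc.
have fDh : f ('d (G (x_ k)) y (y_ k - y) - 'd (G x) y (y_ k - y)) @[k --> \oo] --> f 0.
  by apply: continuous_cvg => //; exact: fc.
have fD : f ('d (G x) y (y_ k)) @[k --> \oo] --> f ('d (G x) y y).
  apply: (yy (f \o 'd (G x) y : {linear X -> R^o})) => v.
  by apply: continuous_comp; [exact: dG_cont|exact: fc].
have fsplit (a b c c1 c2 : Y) :
    c = c1 - c2 -> f (a + b) = f a + (f (b - c) + (f c1 - f c2)).
  by move=> ->; rewrite (raddfD f a b) (raddfB f b) (raddfB f c1) subrK.
have Dh k : 'd (G x) y (y_ k - y) = 'd (G x) y (y_ k) - 'd (G x) y y.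
  exact: (raddfB ('d (G x) y)).
have -> : (fun k => f (z k)) = (fun k => f (G (x_ k) y) + (f ('d (G (x_ k)) y (y_ k - y) -
    'd (G x) y (y_ k - y)) + (f ('d (G x) y (y_ k)) - f ('d (G x) y y)))).
  by apply/funext => k; exact: fsplit (Dh k).
rewrite -[X in _ --> X]addr0 -[X in _ --> _ + X](addr0 0).
apply: cvgD => //; apply: cvgD; first by rewrite -[X in _ --> X](linear0 f).
by rewrite -[X in _ --> X](subrr (f ('d (G x) y y))); apply: cvgB => //; exact: cvg_cst.
Qed.

(** Otherwise some [x_ (k_n)] with [k_n >= n] and points [v_n] converging to [y] would
    contradict the sequential continuity of the derivative. *)
Lemma derivative_uniformly_close (x_ : nat -> X) (x y : X) (e : R) :
    weak_cvg x_ x -> 0 < e ->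
  exists2 r : R, 0 < r & \forall k \near \oo, forall v, `|v - y| < r ->
    operator_norm (fun h => 'd (G (x_ k)) v h - 'd (G x) y h) < e.
Proof.
move=> xx e0; apply: contrapT => H.
have {}H (n : nat) : exists p : nat * X, [/\ (n <= p.1)%N, `|p.2 - y| < n.+1%:R^-1 &
    e <= operator_norm (fun h => 'd (G (x_ (p.1))) (p.2) h - 'd (G x) y h)].
  apply: contrapT => /forallNP Hn; apply: H; exists n.+1%:R^-1 => //.
  exists n => // k /= nk v vy; rewrite ltNge; apply/negP => ev.
  by apply: (Hn (k, v)).
have [p pP] := choice H.
have phi : (fun n => (p n).1) @ \oo --> \oo.
  by apply: cvg_infty_of_ge => n; have [] := pP n.
have vy : (fun n => (p n).2) @ \oo --> y.
  apply: (cvg_of_dist (c := @harmonic R)); last exact: cvg_harmonic.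
  by apply: nearW => n; have [_ /ltW] := pP n.
have [_ /cvgrPdist_lt/(_ e e0)[N _ /(_ N (leqnn N))/=]] :=
  G_cont (weak_cvg_comp phi xx) vy.
rewrite sub0r normrN ltNge => /negP; apply; apply: le_trans (ler_norm _).
by have [] := pP N.
Qed.

(** * The uniform Slater condition *)

Lemma concave_combination x w w' v v' (a : R) : 0 <= a <= 1 ->
    K (G x w - v) -> K (G x w' - v') ->
  K (G x (a *: w + (1 - a) *: w') - (a *: v + (1 - a) *: v')).
Proof.
move=> a01 Kw Kw'.
have b01 : 0 <= 1 - a <= 1 by lra.
have rec : recession_cone K (G x ((1 - (1 - a)) *: w + (1 - a) *: w') -
    (1 - (1 - a)) *: G x w - (1 - a) *: G x w') by exact: G_concave.
have := recession_coneD rec (convex_set_combination K_convex a01 Kw Kw').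
rewrite subKr; congr (K _).
rewrite -(addrA (G _ _)) -opprD !scalerBr [X in _ + X]addrACA -opprD addrA.
by rewrite subrK.
Qed.

(** Only [c] is kept bounded when the covering is cut into countably many convex
    pieces; the elements of [K] may be arbitrarily large. *)
Lemma linearized_openness (g : Y) (D : {linear X -> Y}) (x : X) :
    interior [set g + D (c - x) - z | c in C & z in K] 0 ->
  exists M eta : R, [/\ 0 < M, 0 < eta & forall v e, `|v| < eta -> 0 < e ->
    exists c z, [/\ C c, K z, `|c - x| <= M & `|v - (g + D (c - x) - z)| < e]].
Proof.
move=> /nbhs_normP[rho /= rho0 rhoA].
pose A n : set Y := [set y | exists c z, [/\ C c, K z, `|c - x| <= n%:R &
  y = g + D (c - x) - z]].
have [|||n [eta eta0 dense_ball]] := @baire_convex_union R Y A rho rho0.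
- move=> n; apply: convex_set_of_combinations => v v' a a01.
  move=> [c [z [Cc Kz cn ->]]] [c' [z' [Cc' Kz' cn' ->]]].
  exists (a *: c + (1 - a) *: c'), (a *: z + (1 - a) *: z').
  split; [exact: convex_set_combination|exact: convex_set_combination| |].
    exact: convex_comb_dist.
  have DL (b : R) p q : D (a *: p + b *: q) = a *: D p + b *: D q.
    by rewrite linearP; congr (_ + _); exact: linearZ.
  rewrite convex_combB DL !scalerBr !scalerDr opprD.
  rewrite [LHS]addrACA [X in X + _]addrACA -scalerDl (addrC a) subrK scale1r.
  by rewrite -!addrA.
- move=> m n mn y [c [z [Cc Kz cm ->]]]; exists c, z; split=> //.
  by apply: le_trans cm _; rewrite ler_nat.
- move=> y yrho; have [|c Cc [z Kz yE]] := rhoA y; first by rewrite /= sub0r normrN.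
  exists (Num.truncn `|c - x|).+1, c, z; split=> //.
  by rewrite ltW// truncnS_gt.
exists n.+1%:R, eta; split=> // v e ve e0.
have [_ [c [z [Cc Kz cn ->]]] vc] := dense_ball v e ve e0.
by exists c, z; split=> //; apply: le_trans cn _; rewrite ler_nat.
Qed.

(** For [c] in [C] and [z] in [K] that represent [v / t] approximately in the linearized
    system, the point [ct] at the fraction [t] of the way from [x] to [c] represents
    [v] approximately in the system of [x_ k].  The error is small relative to the
    radius [t * eta], which is what [convex_graph_range] asks for. *)
Lemma uniform_slater (x_ : nat -> X) (x : X) :
    weak_cvg x_ x -> RCQ C K G x ->
  exists M delta : R, 0 < delta /\ \forall k \near \oo, forall v, `|v| < delta ->
    exists w, [/\ C w, `|w - x| <= M & K (G (x_ k) w - v)].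
Proof.
move=> xx [[Cx Kx] /linearized_openness[M [eta [M0 eta0 open0]]]].
have eps0 : 0 < eta / (8 * M) by rewrite divr_gt0// mulr_gt0.
have [r r0 Dclose] := derivative_uniformly_close x xx eps0.
(* t keeps ct inside the ball of radius r; with eta / (8 M) each of the three
   errors below is at most an eighth of t * eta. *)
pose t := Num.min 1 (r / (2 * M)).
have t0 : 0 < t by rewrite lt_min ltr01 divr_gt0// mulr_gt0.
have t1 : t <= 1 by rewrite ge_min lexx.
have tM : t * M < r.
  have : t <= r / (2 * M) by rewrite ge_min lexx orbT.
  rewrite ler_pdivlMr ?mulr_gt0//; lra.
have [Gcvg _] := G_cont xx (cvg_cst x : (fun _ : nat => x) @ \oo --> x).
have te0 : 0 < t * eta / 8 by rewrite divr_gt0// mulr_gt0.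
exists M, (t * eta / 2); split; first by rewrite divr_gt0// mulr_gt0.
move/cvgrPdist_lt : Gcvg => /(_ _ te0) Gclose.
near=> k.
have Dk : forall v, `|v - x| < r -> operator_norm
    (fun h => 'd (G (x_ k)) v h - 'd (G x) x h) < eta / (8 * M) by near: k.
have Gk : `|G x x - G (x_ k) x| < t * eta / 8 by near: k.
pose Gr (w : X) (v : Y) := [/\ C w, `|w - x| <= M & K (G (x_ k) w - v)].
apply: (@convex_graph_range R X Y Gr x M (t * eta)).
- move=> w w' v v' a a01 [Cw wM Kw] [Cw' wM' Kw']; split.
  + exact: convex_set_combination.
  + exact: convex_comb_dist.
  + exact: concave_combination.
- move=> w_ v_ w v Gr_ ww vv; split.
  + by apply: closed_seq_limit C_closed _ ww => n; have [] := Gr_ n.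
  + have : `|w_ n - x| @[n --> \oo] --> `|w - x|.
      by apply: cvg_norm; apply: cvgB => //; exact: cvg_cst.
    apply: (@closed_seq_limit R R^o [set s | s <= M]); first exact: closed_le.
    by move=> n; have [] := Gr_ n.
  + apply: (closed_seq_limit K_closed (u := fun n => G (x_ k) (w_ n) - v_ n)).
      by move=> n; have [] := Gr_ n.
    apply: cvgB => //; apply: continuous_cvg => //.
    exact: differentiable_continuous.
- by move=> w v [].
move=> v vt.
have [|| c [z [Cc Kz cM vc]]] := open0 (t^-1 *: v) (eta / 8).
- by rewrite normrZ gtr0_norm ?invr_gt0// mulrC ltr_pdivrMr// mulrC.
- by rewrite divr_gt0.
pose ct := t *: c + (1 - t) *: x.
have t01 : 0 <= t <= 1 by rewrite ltW.
have ctx : ct - x = t *: (c - x).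
  by rewrite /ct scalerBl scale1r addrA addrAC addrK scalerBr.
have ctM : `|ct - x| <= t * M by rewrite ctx normrZ gtr0_norm// ler_pM2l.
pose q := (1 - t) *: G x x + t *: z.
(* The tangent at ct, evaluated at x, bounds G (x_ k) x from above; read from
   right to left this bounds G (x_ k) ct from below. *)
exists ct, (G (x_ k) x + 'd (G (x_ k)) ct (ct - x) - q); split.
  split; first exact: convex_set_combination.
    by apply: le_trans ctM _; rewrite ler_piMl// ltW.
  have Kq : K q.
    by rewrite /q addrC; exact: convex_set_combination.
  have := @below_tangent (x_ k) ct x (q - G (x_ k) x); rewrite addrCA subrr addr0.
  move=> /(_ Kq); congr (K _).
  rewrite -(opprB ct x) (raddfN ('d (G (x_ k)) ct)).
  by rewrite opprB opprD -addrA; congr (_ + _); rewrite addrCA [- _ - G _ _]addrC.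
have := @le_operator_norm_sub R X Y ('d (G (x_ k)) ct) ('d (G x) x) (ct - x)
  (@dG_cont _ _) (@dG_cont _ _).
have : operator_norm (fun h => 'd (G (x_ k)) ct h - 'd (G x) x h) * `|ct - x|
    <= eta / (8 * M) * (t * M).
  apply: ler_pM => //; first exact: operator_norm_ge0.
  by apply/ltW/Dk; exact: le_lt_trans ctM tM.
rewrite (_ : eta / _ * _ = t * eta / 8); last by field; rewrite gt_eqF.
have DE : 'd (G x) x (ct - x) = t *: 'd (G x) x (c - x).
  by rewrite ctx; exact: linearZ.
move: vc Gk DE; set Dc := 'd (G x) x (c - x); set D1 := 'd (G x) x (ct - x).
set D2 := 'd (G (x_ k)) ct (ct - x); set a := G x x; set b := G (x_ k) x.
set o := operator_norm _ * _.
move=> vc Gk DE oe D12.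
rewrite -(ltr_pM2l t0) -[X in X * `|_|](gtr0_norm t0) -normrZ in vc.
have -> : v - (b + D2 - q) =
    t *: (t^-1 *: v - (a + Dc - z)) + ((a - b) - (D2 - D1)).
  rewrite DE /q scalerBr scalerA mulfV ?gt_eqF// scale1r scalerBl scale1r.
  rewrite scalerBr scalerDr !opprB !opprD.
  rewrite -[RHS]addrA; congr (v + _).
  rewrite [X in _ = _ + X]addrACA [RHS]addrA; congr (_ + _).
  by rewrite (addrC a) -[RHS]addrA (addrA _ _ a) subrK [RHS]addrC (addrC a).
apply: le_lt_trans (ler_normD _ _) _.
have := ler_normB (a - b) (D2 - D1).
by lra.
Unshelve. all: by end_near. Qed.

(** * Recovery sequences and the theorem *)

(** The weight [t] of the Slater point is chosen such that
    [t * v + (1 - t) * e k] vanishes for a [v] of norm at most [delta / 2]. *)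
Lemma recovery_sequence (x_ : nat -> X) (x y : X) :
    weak_cvg x_ x -> RCQ C K G x -> constraint_map C K G x y ->
  exists y_ : nat -> X, (\forall k \near \oo, constraint_map C K G (x_ k) (y_ k)) /\
    y_ @ \oo --> y.
Proof.
move=> xx xRCQ [Cy Ky].
have [M [delta [delta0 slater]]] := uniform_slater xx xRCQ.
have [Gcvg _] := G_cont xx (cvg_cst y : (fun _ : nat => y) @ \oo --> y).
pose e k := G (x_ k) y - G x y.
pose L := (M + `|x - y|) / (delta / 2).
have d2 : 0 < delta / 2 by rewrite divr_gt0.
have /choice[y_ y_P] (k : nat) : exists w,
    (forall v, `|v| < delta ->
      exists w, [/\ C w, `|w - x| <= M & K (G (x_ k) w - v)]) ->
    constraint_map C K G (x_ k) w /\ `|w - y| <= `|e k| * L.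
  have [sk|] := pselect (forall v, `|v| < delta ->
      exists w, [/\ C w, `|w - x| <= M & K (G (x_ k) w - v)]); last by exists y.
  pose t := `|e k| / (`|e k| + delta / 2).
  have ed0 : 0 < `|e k| + delta / 2 by rewrite ltr_wpDl.
  have t01 : 0 <= t <= 1.
    by rewrite divr_ge0 ?(ltW ed0)//= ler_pdivrMr// mul1r lerDl ltW.
  pose v := - (delta / 2 / `|e k|) *: e k.
  have tv : t *: v + (1 - t) *: e k = 0.
    have [e0|e0] := eqVneq (e k) 0; first by rewrite /v e0 !scaler0 addr0.
    have e0' : `|e k| != 0 by rewrite normr_eq0.
    rewrite /v scalerA -scalerDl (_ : _ + _ = 0) ?scale0r// /t.
    by field; rewrite e0' andbT lt0r_neq0 ?ltr_wpDl// mulr_ge0.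
  have [|w [Cw wM Kw]] := sk v.
    rewrite /v normrZ normrN normrM normfV normr_id (gtr0_norm d2).
    have [->|e0] := eqVneq `|e k| 0; first by rewrite mulr0.
    by rewrite divfK// ltr_pdivrMr// ltr_pMr// ltr1n.
  exists (t *: w + (1 - t) *: y) => _; split.
    split; first exact: convex_set_combination.
    have Ke : K (G (x_ k) y - e k) by rewrite /e subKr.
    by have := concave_combination t01 Kw Ke; rewrite tv subr0.
  have -> : t *: w + (1 - t) *: y - y = t *: (w - y).
    by rewrite convex_combB subrr scaler0 addr0.
  case/andP: t01 => t0 t1; rewrite normrZ ger0_norm// /t /L -mulrA.
  rewrite ler_wpM2l// mulrC ler_pM ?invr_ge0 ?(ltW ed0)//.
    have := ler_normD (w - x) (x - y); rewrite subrKA; lra.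
  by rewrite lef_pV2 ?posrE// lerDr.
exists y_; split; first by apply: filterS slater => k /y_P[].
apply: (cvg_of_dist (c := fun k => `|e k| * L)).
  by apply: filterS slater => k /y_P[].
rewrite -(mul0r L); apply: cvgMr_tmp; rewrite -(normr0 Y); apply: cvg_norm.
by rewrite -(subrr (G x y)); apply: cvgB => //; exact: cvg_cst.
Qed.

End ConstraintSystem.

Theorem corollary3p5 (R : realType) (X Y : completeNormedModType R)
    (C : set X) (K : set Y) (G : X -> X -> Y) (xbar : X)
    (C_neq0 : C !=set0) (C_closed : closed C) (C_convex : convex_set C)
    (K_neq0 : K !=set0) (K_closed : closed K) (K_convex : convex_set K)
    (G_diff : forall x y : X, differentiable (G x) y)
    (xbar_feasible : constraint_map C K G xbar xbar)
    (G_concave : concave_wrt_snd (recession_cone K) G)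
    (G_cont : forall (x y : X) (x_ y_ : nat -> X),
       weak_cvg x_ x -> y_ @ \oo --> y ->
       G (x_ k) (y_ k) @[k --> \oo] --> G x y /\
       operator_cvg (fun k => 'd (G (x_ k)) (y_ k)) ('d (G x) y))
    (xbar_RCQ : RCQ C K G xbar) :
  weakly_mosco_continuous (constraint_map C K G) xbar.
Proof.
move=> x_ xx; split=> [y Sy|y_ y Sy [phi [phi_mono yy]]].
  exact: recovery_sequence xx xbar_RCQ Sy.
have phi_ge n : (n <= phi n)%N.
  elim: n => // n IH; apply: leq_ltn_trans IH _; exact: phi_mono.
split.
  apply: closed_convex_weakly_closed C_closed C_convex _ yy => k.
  by have [] := Sy (phi k).
apply: (weak_limit_feasible K_convex K_closed G_diff G_concave G_cont _ yy).
  exact: weak_cvg_comp (cvg_infty_of_ge phi_ge) xx.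
by move=> k; have [] := Sy (phi k).
Qed.
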